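(* Let $\vec{k}=(k_1,\dots,k_\ell)$ be any vector of positive integers and let $a$ be any positive integer. Then the polynomial $$\widetilde{C}_{^a\mathcal{K}}(q,t)=\sum_{\pi\in\mathcal{D}_{^a\mathcal{K}}} q^{\mathrm{area}(\pi)}t^{\mathrm{depth}(\pi)}$$ is $q,t$-symmetric, i.e. $\widetilde{C}_{^a\mathcal{K}}(q,t)=\widetilde{C}_{^a\mathcal{K}}(t,q)$.
   Context: For a vector $\vec{u}=(u_1,\dots,u_m)$ of positive integers put $|\vec u|=u_1+\cdots+u_m$ and $N=|\vec u|+m$. A $\vec u$-Dyck path is a word $\pi=\pi_1\cdots\pi_N$ containing the letters $S^{u_1},S^{u_2},\dots,S^{u_m}$ exactly once each and in this order from left to right, together with $|\vec u|$ letters $W$, such that all starting ranks are nonnegative, where the starting ranks are $r_1=0$, $r_{i+1}=r_i+u_j$ if $\pi_i=S^{u_j}$ and $r_{i+1}=r_i-1$ if $\pi_i=W$. (Equivalently: a lattice path from $(0,0)$ to $(N,0)$ with up steps $(1,u_1),\dots,(1,u_m)$ in this order and down steps $(1,-1)$, never going below the horizontal axis.) $\mathcal{D}_{\vec u}$ denotes the set of such paths. The area sequence is $(a_1,\dots,a_m)$ with $a_j$ the starting rank of the letter $S^{u_j}$, and $\mathrm{area}(\pi)=a_1+\cdots+a_m$. Filling algorithm $\eta_*$: consider a tableau of $m$ top-justified columns, column $i$ having $u_i+1$ cells. Place $1$ at the top of column $1$. For $i=2,\dots,N$: call an entry active if it is currently the bottom entry of a column $i'$ that does not yet contain $u_{i'}+1$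 entries; if $\pi_i=W$, place $i$ immediately below the largest active entry; otherwise place $i$ at the top of the first empty column. The result is $\eta_*(\pi)$. Ranking algorithm $\gamma_*$: in the tableau of the same shape, give column $1$ the ranks $0,1,\dots,u_1$ from top to bottom; for $i\ge 2$, if the top entry of column $i$ of $\eta_*(\pi)$ is $A+1$ and $A$ has rank $\alpha$, give column $i$ the ranks $\alpha,\alpha+1,\dots,\alpha+u_i$ from top to bottom. The depth labeling sequence $(d_1,\dots,d_m)$ is the first row of the ranking tableau, and $\mathrm{depth}(\pi)=d_1+\cdots+d_m$. For $\vec k=(k_1,\dots,k_\ell)$, $\mathcal{K}$ is the set of all distinct rearrangements of $\vec k$, ${}^a\mathcal{K}=\{(a,j_1,\dots,j_\ell):(j_1,\dots,j_\ell)\in\mathcal{K}\}$, and $\mathcal{D}_{^a\mathcal{K}}$ is the union of $\mathcal{D}_{\vec u}$ over $\vec u\in{}^a\mathcal{K}$. *)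

(* Defs.v *)
From mathcomp Require Import all_boot all_order all_algebra polyXY.
Set Implicit Arguments. Unset Strict Implicit. Unset Printing Implicit Defensive.
Import GRing.Theory Num.Theory.

(* A word pi_1 ... pi_N is encoded as a seq bool: true = an up letter S^{u_j},
   false = W.  Since the letters S^{u_1},...,S^{u_m} occur exactly once each and
   in this order, the j-th occurrence of true is the letter S^{u_j}. *)

Fixpoint start_ranks (u : seq nat) (w : seq bool) (r : int) : seq int :=
  match w with
  | [::] => [::]
  | b :: w' => r :: (if b then start_ranks (behead u) w' (r + (head 0%N u)%:Z)%R
                     else start_ranks u w' (r - 1)%R)
  end.

Definition is_dyck (u : seq nat) (w : seq bool) : bool :=
  [&& count id w == size u, count negb w == sumn u
    & all (fun r : int => (0 <= r)%R) (start_ranks u w 0)].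

Fixpoint words (n : nat) : seq (seq bool) :=
  if n is n'.+1 then [seq b :: w | b <- [:: true; false], w <- words n']
  else [:: [::]].

Definition dyck_paths (u : seq nat) : seq (seq bool) :=
  [seq w <- words (sumn u + size u) | is_dyck u w].

Definition area (u : seq nat) (w : seq bool) : nat :=
  `| (\sum_(p <- zip w (start_ranks u w 0) | p.1) p.2)%R |%N.

(* ---- filling algorithm eta_* ----
   tableau = seq of m columns (0-indexed), each column listed top to bottom *)
Definition col (cols : seq (seq nat)) (c : nat) := nth [::] cols c.

Definition active (u : seq nat) (cols : seq (seq nat)) (c : nat) : bool :=
  (col cols c != [::]) && (size (col cols c) < (nth 0 u c).+1).

Definition bottom (cols : seq (seq nat)) (c : nat) : nat := last 0 (col cols c).

Definition fill_step (u : seq nat) (cols : seq (seq nat)) (i : nat) (b : bool) :=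
  if b then set_nth [::] cols (find (@nilp nat) cols) [:: i]
  else
    let act := [seq c <- iota 0 (size cols) | active u cols c] in
    if act is [::] then cols else
    let mx := \max_(c <- act) bottom cols c in
    let c0 := nth 0 act (find (fun c => bottom cols c == mx) act) in
    set_nth [::] cols c0 (rcons (col cols c0) i).

Definition fill (u : seq nat) (w : seq bool) : seq (seq nat) :=
  foldl (fun cols p => fill_step u cols p.1 p.2)
        (set_nth [::] (nseq (size u) [::]) 0 [:: 1])
        (zip (iota 2 (size w).-1) (behead w)).

(* ---- ranking algorithm gamma_*: depth labeling sequence (first row) ---- *)
Definition depth_labels (u : seq nat) (w : seq bool) : seq nat :=
  let cols := fill u w in
  foldl (fun d i =>
           let A := (head 0 (col cols i)).-1 in
           let c := find (fun cl => A \in cl) cols in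
           rcons d (nth 0 d c + index A (col cols c)))
        [:: 0] (iota 1 (size u).-1).

Definition depth (u : seq nat) (w : seq bool) : nat := sumn (depth_labels u w).

Definition aK (a : nat) (k : seq nat) : seq (seq nat) :=
  map (cons a) (permutations k).

(* C~_{^aK}(q,t) in Z[q][t]: q is the inner variable, t the outer one *)
Definition Ctilde (a : nat) (k : seq nat) : {poly {poly int}} :=
  (\sum_(u <- aK a k) \sum_(w <- dyck_paths u)
     ('X^(area u w))%:P * 'X^(depth u w))%R.

(* Main.v *)
From mathcomp Require Import all_boot all_order all_algebra polyXY zify.
Require Import Defs.

Set Implicit Arguments.
Unset Strict Implicit.
Unset Printing Implicit Defensive.

Import GRing.Theory Num.Theory.

(* A path with up steps [u] is the traversal of a plane tree in which a vertex
   with label [k] has slots [0, ..., k], each empty or holding one subtree: the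
   subtrees hanging at an up step of size [k] are read from slot [0] to slot [k],
   separated by [k] letters [W].  The columns of the filling tableau are the
   vertices and its cells are the slots, so a child in slot [r] of a vertex with
   label [k], area [a] and depth [d] has area [a + k - r] and depth [d + r].
   Mirroring the tree exchanges slots [r] and [k - r], hence area and depth; it
   fixes the root label and permutes the other labels. *)

(** * Plane trees, their statistics and their mirror images *)

Inductive tree := Leaf | Node of seq tree.

(** The generated induction principle gives no hypothesis on trees nested in the list; the [foldr]
    conjunction supplies one for each subtree. *)
Lemma tree_ind_all (Q : tree -> Prop) :
  Q Leaf -> (forall s, foldr (fun t => and (Q t)) True s -> Q (Node s)) ->
  forall t, Q t.
Proof.
move=> QL QN; fix IH 1 => -[//|s]; apply: QN.
by elim: s => //= t s IHs; split.
Qed.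

(** A label [k] means [k + 1] slots, so a vertex without slots has no meaningful label. *)
Fixpoint wf t := if t is Node s then (0 < size s) && all wf s else true.

Fixpoint mirror t := if t is Node s then Node (rev (map mirror s)) else Leaf.

Fixpoint labels t :=
  if t is Node s then (size s).-1 :: flatten (map labels s) else [::].

(** [behead] drops the [W] before slot 0, leaving one [W] between consecutive slots. *)
Fixpoint word t :=
  if t is Node s then true :: behead (flatten [seq false :: word t | t <- s])
  else [::].

(** Total area when the root has area [b]. The inner fixpoint is there for the guard condition;
    [farea] is its standalone form. *)
Fixpoint tarea b t :=
  if t is Node s then
    b + (fix go s := if s is t :: s' then tarea (b + size s') t + go s' else 0) s
  else 0.

Fixpoint tdepth b t :=
  if t is Node s then
    b + (fix go b s := if s is t :: s' then tdepth b t + go b.+1 s' else 0) b s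
  else 0.

Fixpoint farea b s :=
  if s is t :: s' then tarea (b + size s') t + farea b s' else 0.

Fixpoint fdepth b s := if s is t :: s' then tdepth b t + fdepth b.+1 s' else 0.

Lemma tarea_Node b s : tarea b (Node s) = b + farea b s.
Proof. by congr (_ + _); elim: s => //= t s ->. Qed.

Lemma tdepth_Node b s : tdepth b (Node s) = b + fdepth b s.
Proof. by congr (_ + _); elim: s b => //= t s IHs b; rewrite IHs. Qed.

Arguments tarea : simpl never.
Arguments tdepth : simpl never.

(** Area offsets count the slots to the right, so appending [s2] raises those of [s1]. *)
Lemma farea_cat b s1 s2 :
  farea b (s1 ++ s2) = farea (b + size s2) s1 + farea b s2.
Proof.
elim: s1 => //= t s1 ->; rewrite size_cat.
by rewrite -addnA [in size s1 + _]addnC addnA -!addnA addnA.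
Qed.

Lemma tarea_mirror t b : tarea b (mirror t) = tdepth b t.
Proof.
elim/tree_ind_all: t b => // s IHs b.
rewrite [mirror _]/= tarea_Node tdepth_Node; congr (_ + _).
elim: s b IHs => //= t s IH b [IHt IHs].
by rewrite rev_cons -cats1 farea_cat /= addn1 addn0 IHt IH // addn0 addnC.
Qed.

Lemma mirrorK : involutive mirror.
Proof.
elim/tree_ind_all=> //= s IHs; congr Node.
rewrite map_rev revK -map_comp.
by elim: s IHs => //= t s IH [-> /IH ->].
Qed.

Lemma tdepth_mirror t b : tdepth b (mirror t) = tarea b t.
Proof. by rewrite -tarea_mirror mirrorK. Qed.

Lemma wf_mirror t : wf t -> wf (mirror t).
Proof.
elim/tree_ind_all: t => //= s IHs /andP[s_gt0 wfs].
rewrite size_rev size_map s_gt0 /= all_rev.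
by elim: s IHs wfs {s_gt0} => //= t s IH [IHt IHs] /andP[/IHt-> /IH->].
Qed.

Lemma labels_mirror t : perm_eq (labels (mirror t)) (labels t).
Proof.
elim/tree_ind_all: t => //= s IHs.
rewrite size_rev size_map perm_cons map_rev.
apply: (@perm_trans _ (flatten (map labels (map mirror s)))).
  by apply: perm_flatten; rewrite perm_rev.
by elim: s IHs => //= t s IH [IHt IHs]; rewrite perm_cat // IH.
Qed.

(** * Paths as words of trees: validity, parsing and area *)

(** [r] is the current rank and [u] the up steps still to come; the path has to end at rank 0. *)
Fixpoint valid r (u : seq nat) (w : seq bool) : bool :=
  match w, u, r with
  | [::], _, _ => nilp u && (r == 0)
  | true :: w', k :: u', _ => valid (r + k) u' w'
  | false :: w', _, r'.+1 => valid r' u w'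
  | _, _, _ => false
  end.

Lemma validE r u w : valid r u w =
  [&& count id w == size u, count negb w == sumn u + r
    & all (fun x : int => (0 <= x)%R) (start_ranks u w r%:Z)].
Proof.
elim: w u r => [|[] w IHw] u r /=.
- by case: u => [|k u] /=; rewrite ?andbT // add0n eq_sym.
- case: u => [|k u] //=.
  by rewrite IHw eqSS add0n -PoszD [r + k]addnC addnA [sumn u + k]addnC.
- rewrite add0n add1n; case: r => [|r].
  (* A [W] at rank 0 leads to rank -1. If it is the last letter, that rank is not listed among the
     starting ranks, and the counts give the contradiction instead. *)
  + apply/esym/negP => /and3P[/eqP cu /eqP cn].
    by case: w {IHw} cu cn => [|b w] //=; case: u.
  + rewrite IHw addnS eqSS.
    by have -> : (r.+1%:Z - 1 = r%:Z)%R by lia.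
Qed.

Lemma is_dyckE u w : is_dyck u w = valid 0 u w.
Proof. by rewrite validE addn0. Qed.

(* A word suffix starting at rank [r] reads [t_0 W t_1 W ... W t_r], so it is
   parsed from right to left into a list of [r + 1] trees. *)
Fixpoint parse (u : seq nat) (w : seq bool) : seq tree :=
  match w with
  | [::] => [:: Leaf]
  | true :: w' => let s := parse (behead u) w' in
                  Node (take (head 0 u).+1 s) :: drop (head 0 u).+1 s
  | false :: w' => Leaf :: parse u w'
  end.

Lemma size_parse r u w : valid r u w -> size (parse u w) = r.+1.
Proof.
elim: w u r => [|[] w IHw] u r /=.
- by case/andP=> _ /eqP->.
- by case: u => //= k u /IHw; rewrite size_drop => ->; lia.
- by case: r => // r /IHw ->.
Qed.

Lemma wf_parse r u w : valid r u w -> all wf (parse u w).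
Proof.
elim: w u r => [|[] w IHw] u r //=.
- case: u => //= k u v; move: (IHw _ _ v) (size_parse v).
  rewrite -{1}(cat_take_drop k.+1 (parse u w)) all_cat => /andP[-> ->].
  by rewrite size_take => ->; case: ifP; rewrite ?andbT.
- by case: r => // r /IHw ->.
Qed.

Lemma labels_parse r u w : valid r u w -> flatten (map labels (parse u w)) = u.
Proof.
elim: w u r => [|[] w IHw] u r /=.
- by case: u.
- case: u => //= k u v; rewrite size_takel ?(size_parse v) ?ltnS ?leq_addl //.
  by rewrite -flatten_cat -map_cat cat_take_drop (IHw _ _ v).
- by case: r => // r /IHw.
Qed.

Lemma word_parse r u w : valid r u w ->
  flatten [seq false :: word t | t <- parse u w] = false :: w.
Proof.
elim: w u r => [|[] w IHw] u r //=.
- case: u => //= k u v; move: (IHw _ _ v) (size_parse v).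
  rewrite -{1}(cat_take_drop k.+1 (parse u w)) map_cat flatten_cat.
  by case: (parse u w) => //= t s [->].
- by case: r => // r /IHw ->.
Qed.

(** The suffix [w] begins with an empty slot, and the word of [t] put in front of it fills that
    slot. The trailing [u] and [w] make the induction over the subtrees possible. *)
Lemma parse_cat t u w s : wf t -> parse u w = Leaf :: s ->
  parse (labels t ++ u) (word t ++ w) = t :: s.
Proof.
elim/tree_ind_all: t u w s => //= cs IHcs u w s /andP[cs0 wfcs] e.
suff -> : parse (flatten (map labels cs) ++ u)
   (behead (flatten [seq false :: word t | t <- cs]) ++ w) = cs ++ s.
  by rewrite prednK // take_size_cat // drop_size_cat.
elim: cs cs0 IHcs wfcs => //= t cs IH _ [IHt IHcs] /andP[wft wfcs].
rewrite -!catA; apply: IHt => //.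
case: cs IH IHcs wfcs => [|t' cs] IH IHcs wfcs //=.
by rewrite IH.
Qed.

Lemma parse_word t : wf t -> parse (labels t) (word t) = [:: t].
Proof.
by move=> wft; rewrite -[labels t]cats0 -[word t]cats0; apply: parse_cat.
Qed.

(** The traversal of a tree returns to its starting rank without going below it. *)
Lemma valid_cat t r u w : wf t -> valid r u w ->
  valid r (labels t ++ u) (word t ++ w).
Proof.
elim/tree_ind_all: t r u w => //= cs IHcs r u w /andP[cs0 wfcs] v.
elim: cs cs0 IHcs wfcs => //= t cs IH _ [IHt IHcs] /andP[wft wfcs].
rewrite -!catA; apply: IHt => //.
case: cs IH IHcs wfcs => [|t' cs] IH IHcs wfcs /=; first by rewrite addn0.
by rewrite addnS; apply: IH.
Qed.

Lemma valid_word t : wf t -> valid 0 (labels t) (word t).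
Proof.
by move=> wft; rewrite -[labels t]cats0 -[word t]cats0; apply: valid_cat.
Qed.

(** With [parse_word] and [valid_word], this makes paths and well-formed trees correspond
    bijectively. *)
Lemma parseE u w : valid 0 u w ->
  exists t, [/\ parse u w = [:: t], wf t, labels t = u & word t = w].
Proof.
move=> v; move: (size_parse v) (wf_parse v) (labels_parse v) (word_parse v).
case: (parse u w) => [|t []] //= _ /andP[wft _].
by rewrite !cats0 => lt [wt]; exists t.
Qed.

Lemma area_parse u w : valid 0 u w -> area u w = farea 0 (parse u w).
Proof.
rewrite /area => v.
(* For a suffix starting at rank [r], the area of each slot is the number of slots after it, hence
   the offset 0 in [farea]. *)
suff sumE r : valid r u w ->
    (\sum_(p <- zip w (start_ranks u w r%:Z) | p.1) p.2 =
    (farea 0 (parse u w))%:Z)%R by rewrite (sumE 0).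
elim: w u r {v} => [|[] w IHw] u r /=.
- by rewrite big_nil.
- case: u => //= k u v; rewrite big_cons /= -PoszD (IHw _ _ v).
  rewrite [tarea _ _]tarea_Node add0n -addnA.
  rewrite -[in LHS](cat_take_drop k.+1 (parse u w)) farea_cat add0n.
  by rewrite size_drop (size_parse v); lia.
- case: r => // r v; rewrite big_cons /= -(IHw _ _ v).
  by have -> : (r.+1%:Z - 1 = r%:Z)%R by lia.
Qed.

(** * Depth computed with a stack of cell ranks *)

(* [s] lists the ranks of the current entry and of all cells still to be
   filled, in the order in which they will be filled. *)
Fixpoint stack_depth (s u : seq nat) (w : seq bool) : nat :=
  match w with
  | [::] => 0
  | true :: w' => head 0 s
      + stack_depth (iota (head 0 s) (head 0 u).+1 ++ behead s) (behead u) w'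
  | false :: w' => stack_depth (behead s) u w'
  end.

Lemma sum_tdepth_iota x ts :
  \sum_(p <- zip (iota x (size ts)) ts) tdepth p.1 p.2 = fdepth x ts.
Proof. by elim: ts x => [|t ts IH] x /=; rewrite ?big_nil // big_cons IH. Qed.

(** Stack entries and parsed trees match one to one. An up step replaces the top rank [x] by the
    ranks [x, ..., x + k] of its new column, which are the depths of the slots of the new vertex. *)
Lemma stack_depth_parse r x s u w : size s = r -> valid r u w ->
  stack_depth (x :: s) u w = \sum_(p <- zip (x :: s) (parse u w)) tdepth p.1 p.2.
Proof.
elim: w r x s u => [|[] w IHw] r x s u sz /=.
- by case: s {sz} => [|y s] _; rewrite big_cons big_nil.
- case: u => //= k u v; rewrite -sz in v.
  rewrite (IHw (size s + k)) //; last by rewrite size_cat size_iota addnC.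
  rewrite big_cons [tdepth _ _]tdepth_Node -addnA /=; congr (_ + _).
  have sz_take : size (take k.+1 (parse u w)) = k.+1.
    by rewrite size_takel // (size_parse v); lia.
  rewrite -sum_tdepth_iota sz_take -{1}(cat_take_drop k.+1 (parse u w)).
  by rewrite -[x :: _]/(iota x k.+1 ++ s) zip_cat ?size_iota // big_cat.
- case: r s sz => [|r] [|y s] //= [sz] v.
  by rewrite big_cons /= (IHw r).
Qed.

(** * Correctness of the filling and ranking algorithms *)

(* Invariant of the filling algorithm for the shape [u] after [n] letters, [j]
   of them up steps: [D] lists the depth labels of the open columns, [cur] is the
   cell (column, row) of the last entry, and [P] lists the cells of the open
   columns that are still empty, in the order in which they will be filled. *)
Record fill_inv (u : seq nat) (n j : nat) (cols : seq (seq nat)) (D : seq nat)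
    (cur : nat * nat) (P : seq (nat * nat)) : Prop := FillInv {
  inv_size : size cols = size u;
  inv_j : 0 < j <= size u;
  inv_open : forall c, (col cols c != [::]) = (c < j);
  inv_sizeD : size D = j;
  inv_D0 : nth 0 D 0 = 0;
  inv_cells : forall c, c < j -> [seq p.2 | p <- P & p.1 == c] =
    iota (size (col cols c)) ((nth 0 u c).+1 - size (col cols c));
  inv_P : forall p, p \in P -> p.1 < j;
  inv_le : forall c e, e \in col cols c -> e <= n;
  inv_disj : forall c c' e, e \in col cols c -> e \in col cols c' -> c = c';
  inv_cur : [/\ cur.1 < j, n \in col cols cur.1 & cur.2 = index n (col cols cur.1)];
  inv_label : forall i, 0 < i < j -> exists c,
    [/\ c < i, (head 0 (col cols i)).-1 \in col cols c
      & nth 0 D i = nth 0 D c + index (head 0 (col cols i)).-1 (col cols c)];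
  inv_sorted : pairwise (fun p p' => bottom cols p'.1 <= bottom cols p.1) P }.

(** The rank of the cell in the ranking tableau. *)
Definition cell_rank (D : seq nat) (p : nat * nat) := nth 0 D p.1 + p.2.

Lemma bottom_in cols c : col cols c != [::] -> bottom cols c \in col cols c.
Proof. by rewrite /bottom; case: (col cols c) => //= x s _; rewrite mem_last. Qed.

Lemma col_set_nth cols c s c' :
  col (set_nth [::] cols c s) c' = if c' == c then s else col cols c'.
Proof. by rewrite /col nth_set_nth /=. Qed.

(** The new column has the largest bottom entry, so its empty cells come first in the order of
    filling; its label is the rank of the cell holding [n]. *)
Lemma fill_inv_up u n j cols D cur P : fill_inv u n j cols D cur P ->
  j < size u ->
  fill_inv u n.+1 j.+1 (fill_step u cols n.+1 true) (rcons D (cell_rank D cur))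
    (j, 0) ([seq (j, i) | i <- iota 1 (nth 0 u j)] ++ P).
Proof.
case=> sz /andP[j0 ju] opn szD D0 cells Pj le disj [curj ncur rcur] lab srt jlt.
have colj : col cols j = [::].
  by apply/eqP; rewrite -[_ == _]negbK opn ltnn.
have findj : find (@nilp nat) cols = j.
  case: findP => [/hasPn nn|i ilt /(_ [::])]; first last.
    move=> nili /(_ [::]) bef; apply/eqP; rewrite eqn_leq; apply/andP; split.
      rewrite leqNgt; apply/negP => /bef.
      by rewrite -/(col cols j) colj.
    by rewrite leqNgt -opn negbK; apply/eqP/nilP.
  have /nn : col cols j \in cols by rewrite mem_nth ?sz.
  by rewrite colj.
have colE c : col (fill_step u cols n.+1 true) c =
    if c == j then [:: n.+1] else col cols c.
  by rewrite /fill_step findj col_set_nth.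
have nthD c : c < j -> nth 0 (rcons D (cell_rank D cur)) c = nth 0 D c.
  by move=> cj; rewrite nth_rcons szD cj.
split.
- by rewrite /fill_step findj size_set_nth sz; apply/maxn_idPr.
- by rewrite jlt.
- move=> c; rewrite colE ltnS leq_eqVlt; case: (c =P j) => // _; exact: opn.
- by rewrite size_rcons szD.
- by rewrite nthD.
- move=> c; rewrite ltnS leq_eqVlt colE filter_cat map_cat.
  case: eqVneq => [-> _|cj /= clt].
    rewrite filter_map -map_comp /= [X in _ ++ X](_ : _ = [::]); last first.
      case E: [seq p <- P | p.1 == j] => [//|p s].
      have : p \in [seq p <- P | p.1 == j] by rewrite E mem_head.
      by rewrite mem_filter => /andP[/eqP pj /Pj]; rewrite pj ltnn.
    rewrite cats0 subn1 /= -[RHS]map_id; congr map.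
    by apply/all_filterP/allP => i _ /=; rewrite eqxx.
  rewrite cells // [X in X ++ _](_ : _ = [::]) //.
  by rewrite filter_map -map_comp /preim /= eq_sym (negPf cj) filter_pred0.
- move=> p; rewrite mem_cat => /orP[/mapP[i _ ->] //|/Pj] /ltnW; exact.
- move=> c e; rewrite colE; case: eqP => _; last by move/le/leqW.
  by rewrite inE => /eqP->.
- move=> c c' e; rewrite !colE; case: eqP => [->|_]; case: eqP => [->|_] //.
  + by rewrite inE => /eqP-> /le; rewrite ltnn.
  + by move=> /le h; rewrite inE => /eqP E; rewrite E ltnn in h.
  + exact: disj.
- by rewrite /= colE eqxx ltnSn inE eqxx /=; rewrite eqxx.
- move=> i /andP[i0]; rewrite ltnS leq_eqVlt => /predU1P[->|ilt].
    (* The new top entry is [n.+1], so the entry [A] of the ranking algorithm is [n], which lies in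
       column [cur.1]. *)
    exists cur.1; rewrite !colE eqxx /= (ltn_eqF curj); split=> //.
    by rewrite nth_rcons szD ltnn eqxx nthD // /cell_rank rcur.
  have [|c [ci cin E]] := lab i; first by rewrite i0.
  have clt := ltn_trans ci ilt.
  exists c; rewrite !colE (ltn_eqF ilt) (ltn_eqF clt); split=> //.
  by rewrite !nthD.
- have botE c : c < j -> bottom (fill_step u cols n.+1 true) c = bottom cols c.
    by move=> cj; rewrite /bottom colE ltn_eqF.
  have botj : bottom (fill_step u cols n.+1 true) j = n.+1.
    by rewrite /bottom colE eqxx.
  rewrite pairwise_cat; apply/and3P; split.
  + apply/allrelP => _ p /mapP[i _ ->] /Pj pj /=.
    by rewrite botj botE // leqW // (le p.1) // bottom_in ?opn.
  + by rewrite pairwise_map; apply/(pairwiseP 0) => a b _ _ _ /=.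
  + apply: sub_in_pairwise srt => [p p' /Pj pj /Pj pj' /=|]; last exact/allP.
    by rewrite !botE.
Qed.

(** By [inv_sorted], the first cell of the list lies in the column of the largest active entry,
    which is where the algorithm puts the next [W]. *)
Lemma fill_inv_down u n j cols D cur c0 r0 P :
  fill_inv u n j cols D cur ((c0, r0) :: P) ->
  fill_inv u n.+1 j (fill_step u cols n.+1 false) D (c0, r0) P.
Proof.
case=> sz /andP[j0 ju] opn szD D0 cells Pj le disj _ lab.
rewrite pairwise_cons => /andP[top srt].
set cols' := fill_step _ _ _ _.
have c0j : c0 < j := Pj _ (mem_head _ _).
have := cells _ c0j; rewrite /= eqxx /=.
case E: (_ - _) => [//|d] /= [r0E restE].
have act0 : active u cols c0 by rewrite /active opn c0j -subn_gt0 E.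
(* An active column other than [c0] still has an empty cell in [P], so [top] applies to it. *)
have bot_le c : active u cols c -> bottom cols c <= bottom cols c0.
  rewrite /active opn => /andP[cj]; rewrite -subn_gt0.
  have := cells _ cj; case: (_ - _) => [//|d'] /=.
  case: eqP => [<- //|_] cellsE _.
  have : size (col cols c) \in [seq p.2 | p <- P & p.1 == c].
    by rewrite cellsE mem_head.
  case/mapP=> p; rewrite mem_filter => /andP[/eqP <- pP] _.
  exact: (allP top).
(* Columns share no entry, so the maximum determines the column. *)
have bot_inj c : c < j -> bottom cols c = bottom cols c0 -> c = c0.
  move=> cj bE; apply: (disj _ _ (bottom cols c)); first by rewrite bottom_in ?opn.
  by rewrite bE bottom_in ?opn.
have stepE : cols' = set_nth [::] cols c0 (rcons (col cols c0) n.+1).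
  rewrite /cols' /fill_step; set act := [seq c <- _ | _].
  have c0act : c0 \in act.
    by rewrite mem_filter act0 mem_iota sz (leq_trans c0j ju).
  have maxE : \max_(c <- act) bottom cols c = bottom cols c0.
    apply/eqP; rewrite eqn_leq leq_bigmax_seq // andbT.
    by apply/bigmax_leqP_seq => c; rewrite mem_filter => /andP[/bot_le].
  have hasc : has (fun c => bottom cols c == bottom cols c0) act.
    by apply/hasP; exists c0.
  have := nth_find 0 hasc; have := mem_nth 0 (etrans (esym (has_find _ _)) hasc).
  rewrite {1}/act mem_filter /active opn => /andP[/andP[cj _] _] /eqP bE.
  rewrite maxE (bot_inj _ cj bE).
  by case: act c0act {maxE hasc cj bE}.
clearbody cols'.
have colE c : col cols' c =
    if c == c0 then rcons (col cols c0) n.+1 else col cols c.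
  by rewrite stepE col_set_nth.
have nin c : n.+1 \in col cols c = false.
  by apply/negP => /le; rewrite ltnn.
have subcol c e : e \in col cols c -> (e \in col cols' c)
    /\ index e (col cols' c) = index e (col cols c).
  rewrite colE; case: eqP => [->|//] ein.
  by rewrite mem_rcons inE ein orbT -cats1 index_cat ein.
have headE c : c < j ->
    head 0 (col cols' c) = head 0 (col cols c).
  rewrite colE; case: eqP => [->|//]; rewrite -opn.
  by case: (col cols c0).
have memE c e : e \in col cols' c ->
    (e = n.+1 /\ c = c0) \/ e \in col cols c.
  rewrite colE; case: eqP => [->|]; last by right.
  by rewrite mem_rcons inE => /orP[/eqP|]; [left|right].
split=> //.
- by rewrite stepE size_set_nth sz; apply/maxn_idPr/(leq_trans c0j).
- by rewrite j0.
- move=> c; rewrite -opn colE; case: (c =P c0) => [->|//].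
  by rewrite opn c0j; case: (col cols c0).
- move=> c cj; rewrite colE; case: eqP => [->|/eqP cc0].
    by rewrite size_rcons restE; congr iota; lia.
  by rewrite -cells //= eq_sym (negPf cc0).
- by move=> p pP; apply: Pj; rewrite inE pP orbT.
- by move=> c e /memE[[-> _]|/le/leqW].
- move=> c c' e /memE[[-> ->]|ec] /memE[[eE ->]|ec'] //.
  + by rewrite nin in ec'.
  + by rewrite eE nin in ec.
  + exact: disj ec ec'.
- rewrite /= colE eqxx c0j mem_rcons mem_head; split=> //.
  by rewrite -cats1 index_cat nin /= eqxx addn0.
- move=> i /andP[i0 ij]; have [|c [ci cin DE]] := lab i; first by rewrite i0.
  exists c; rewrite headE // ci DE.
  by have [-> ->] := subcol _ _ cin.
- have botE c : c < j -> bottom cols' c =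
      if bottom cols c == bottom cols c0 then n.+1 else bottom cols c.
    move=> cj; rewrite /bottom colE; case: (eqVneq c c0) => [->|cc0].
      by rewrite eqxx last_rcons.
    case: eqP => // /(bot_inj _ cj) ccE; by rewrite ccE eqxx in cc0.
  have Pj' p : p \in P -> p.1 < j by move=> pP; apply: Pj; rewrite inE pP orbT.
  have bot_n c : c < j -> bottom cols c <= n.
    by move=> cj; apply: (le c); rewrite bottom_in ?opn.
  apply: (@sub_in_pairwise _ [in P] _ _ _ P _ srt) => [p p' pP p'P /= lepp'|];
    last exact/allP.
  (* The only new bottom entry is [n.+1], in column [c0]. By [top], a cell of [P] preceding one of
     column [c0] must have the same old bottom entry, so it gets [n.+1] too. *)
  have := allP top _ pP; have := allP top _ p'P.
  have := bot_n _ (Pj' _ pP); have := bot_n _ (Pj' _ p'P).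
  rewrite /= !botE ?Pj' //; do 2 case: eqP; lia.
Qed.

(** Each up step appends to the labels the rank of the current cell, which is the head of the stack
    in [stack_depth]. *)
Lemma fill_inv_foldl u w n j cols D cur P :
  fill_inv u n j cols D cur P -> valid (size P) (drop j u) w ->
  exists n' D' cur' P', fill_inv u n' (size u)
      (foldl (fun cols p => fill_step u cols p.1 p.2) cols
         (zip (iota n.+1 (size w)) w)) D' cur' P'
    /\ sumn D' = sumn D + stack_depth (map (cell_rank D) (cur :: P)) (drop j u) w.
Proof.
elim: w n j cols D cur P => [|[] w IHw] n j cols D cur P inv /=.
- case/andP=> /nilP dropE _; exists n, D, cur, P; rewrite addn0; split=> //.
  suff -> : size u = j by [].
  have /andP[_ ju] := inv_j inv; apply/eqP; rewrite eqn_leq ju andbT.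
  by rewrite -subn_eq0 -size_drop dropE.
- have [jlt|uj] := ltnP j (size u); last by rewrite drop_oversize.
  rewrite (drop_nth 0 jlt) /= => v.
  have [|n' [D' [cur' [P' [inv' sumE]]]]] := IHw _ _ _ _ _ _ (fill_inv_up inv jlt).
    by rewrite size_cat size_map size_iota addnC.
  exists n', D', cur', P'; split=> //.
  rewrite sumE sumn_rcons -addnA; congr (_ + (_ + stack_depth _ _ _)).
  have [curj _ _] := inv_cur inv.
  rewrite /= /cell_rank /= nth_rcons (inv_sizeD inv) ltnn eqxx addn0; congr (_ :: _).
  rewrite map_cat -map_comp; congr (_ ++ _).
    rewrite -[(_ + cur.2).+1]addn1 iotaDl; apply: eq_map => i /=.
    by rewrite nth_rcons (inv_sizeD inv) ltnn eqxx.
  apply/eq_in_map => p /(inv_P inv) pj.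
  by rewrite /cell_rank nth_rcons (inv_sizeD inv) pj.
- case: P inv => [//|[c0 r0] P] inv v.
  by have [n' [D' [cur' [P' H]]]] := IHw _ _ _ _ _ _ (fill_inv_down inv) v;
    exists n', D', cur', P'.
Qed.

(** The ranking algorithm reads the final tableau from left to right; [inv_label] refers only to
    columns already ranked, and disjointness of columns makes [find] hit the right one. *)
Lemma fill_inv_depth_labels u w n D cur P :
  fill_inv u n (size u) (fill u w) D cur P -> depth_labels u w = D.
Proof.
move=> inv; rewrite /depth_labels.
have /andP[u0 _] := inv_j inv; have szD := inv_sizeD inv.
set F := fun _ => _.
suff foldE i : i < size u -> foldl F [:: 0] (iota 1 i) = take i.+1 D.
  by rewrite foldE ?prednK // take_oversize ?szD.
elim: i => [_|i IHi ilt].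
  by rewrite (take_nth 0) ?szD // take0 (inv_D0 inv).
rewrite -[X in iota 1 X]addn1 iotaD foldl_cat IHi ?(ltnW ilt) //= add1n.
have [//|c [ci cin DE]] := inv_label inv (i := i.+1).
have findE : find (fun cl => (head 0 (col (fill u w) i.+1)).-1 \in cl) (fill u w) = c.
  have c_lt : c < size (fill u w) by rewrite (inv_size inv) (ltn_trans ci).
  case: findP => [/hasPn nn|i' ilt' /(_ [::]) ain _].
    by have := nn _ (mem_nth [::] c_lt); rewrite cin.
  exact: (inv_disj inv ain cin).
by rewrite /F findE nth_take // -DE -take_nth ?szD.
Qed.

Lemma depth_parse u w : 0 < size u -> valid 0 u w ->
  depth u w = fdepth 0 (parse u w).
Proof.
case: u w => // k u [|[] w] // _ v.
(* A valid path starts with an up step, which puts 1 on top of the first column and leaves rows 1 to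
   [k] to fill. *)
have inv1 : fill_inv (k :: u) 1 1 (set_nth [::] (nseq (size (k :: u)) [::]) 0 [:: 1])
    [:: 0] (0, 0) [seq (0, i) | i <- iota 1 k].
  have colE c : col (set_nth [::] (nseq (size (k :: u)) [::]) 0 [:: 1]) c =
      if c == 0 then [:: 1] else [::].
    by rewrite col_set_nth /col nth_nseq if_same.
  split=> //.
  - by rewrite size_set_nth size_nseq; apply/maxn_idPr.
  - by move=> c; rewrite colE; case: c.
  - case=> // _; rewrite colE /= subn1 filter_map -map_comp /=.
    by rewrite filter_predT map_id.
  - by move=> p /mapP[i _ ->].
  - by move=> c e; rewrite colE; case: c => // /[!inE] /eqP->.
  - by move=> [|c] [|c'] e; rewrite !colE.
  - by case.
  - by rewrite pairwise_map; apply/(pairwiseP 0) => a b _ _ _ /=.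
have [|n' [D' [cur' [P' [inv' sumE]]]]] := fill_inv_foldl (w := w) inv1.
  by rewrite size_map size_iota /= drop0.
rewrite /depth (fill_inv_depth_labels (w := true :: w) inv') sumE.
rewrite -sum_tdepth_iota (size_parse v) -(stack_depth_parse (s := [::]) 0 _ v) //= drop0.
congr stack_depth; rewrite cats0; congr (_ :: _).
rewrite -map_comp -[RHS]map_id; apply: eq_map => i.
by rewrite /cell_rank /=.
Qed.

(** * The involution on paths and the symmetry *)

(** Mirroring may permute the up steps, so the map acts on pairs of a vector and a word. A path
    parses into a single tree, which [head] extracts. *)
Definition mirror_path (p : seq nat * seq bool) : seq nat * seq bool :=
  let t := mirror (head Leaf (parse p.1 p.2)) in (labels t, word t).

Lemma mem_words n w : (w \in words n) = (size w == n).
Proof.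
elim: n w => [|n IHn] w /=; first by rewrite inE; case: w.
rewrite cats0 mem_cat.
case: w => [|b w] /=.
  by apply/negP => /orP[] /mapP[].
rewrite eqSS -IHn; apply/orP/idP => [[] /mapP[w' ? [_ ->]] //|win].
by case: b; [left|right]; rewrite mem_map // => ? ? [].
Qed.

Lemma words_uniq n : uniq (words n).
Proof.
elim: n => //= n IHn.
rewrite cats0 cat_uniq !map_inj_uniq ?IHn => [|? ? []|? ? []] //=.
by rewrite andbT; apply/hasPn => _ /mapP[w _ ->]; apply/mapP => -[].
Qed.

Lemma mem_dyck_paths u w : (w \in dyck_paths u) = valid 0 u w.
Proof.
rewrite mem_filter mem_words is_dyckE; apply: andb_idr.
rewrite validE addn0 => /and3P[/eqP cu /eqP cn _].
by rewrite -(count_predC id) cu -cn addnC.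
Qed.

Lemma mirror_pathP p : valid 0 p.1 p.2 -> 0 < size p.1 ->
  [/\ valid 0 (mirror_path p).1 (mirror_path p).2,
     mirror_path (mirror_path p) = p,
     perm_eq (mirror_path p).1 p.1 /\ head 0 (mirror_path p).1 = head 0 p.1,
     area (mirror_path p).1 (mirror_path p).2 = depth p.1 p.2
   & depth (mirror_path p).1 (mirror_path p).2 = area p.1 p.2].
Proof.
case: p => u w v u0; rewrite /= in v u0; have [t [pE wft lE wE]] := parseE v.
have wfm := wf_mirror wft; have vm := valid_word wfm.
have pm : mirror_path (u, w) = (labels (mirror t), word (mirror t)).
  by rewrite /mirror_path /= pE.
have perm := labels_mirror t.
rewrite pm; split=> //.
- by rewrite /mirror_path [parse _ _]parse_word //= mirrorK lE wE.
- rewrite /= -lE; split=> //.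
  (* The root label comes first, and reversing the slots keeps their number. *)
  by case: (t) => //= s; rewrite size_rev size_map.
- rewrite /= area_parse // depth_parse // pE parse_word //=.
  by rewrite tarea_mirror.
- rewrite /= area_parse // depth_parse // ?pE ?parse_word //=.
    by rewrite tdepth_mirror.
  by rewrite (perm_size perm) lE.
Qed.

(** An involution preserving [L] permutes it; this justifies reindexing the sum. *)
Lemma mirror_path_perm (L : seq (seq nat * seq bool)) : uniq L ->
  {in L, forall p, mirror_path p \in L} ->
  {in L, forall p, mirror_path (mirror_path p) = p} ->
  perm_eq (map mirror_path L) L.
Proof.
move=> uL mL mK.
have uM : uniq (map mirror_path L).
  by rewrite map_inj_in_uniq // => p q pL qL E; rewrite -(mK p) // E mK.
apply: uniq_perm => // p; apply/mapP/idP => [[q qL ->]|pL]; first exact: mL.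
by exists (mirror_path p); rewrite ?mL ?mK.
Qed.

Theorem theorem1p1 (k : seq nat) (a : nat) :
  all (fun x => 0 < x) k -> 0 < a -> swapXY (Ctilde a k) = Ctilde a k.
Proof.
move=> _ _.
pose L := [seq (u, w) | u <- aK a k, w <- dyck_paths u].
have memL p : p \in L -> [/\ valid 0 p.1 p.2, 0 < size p.1 & p.1 \in aK a k].
  case/allpairsPdep=> u [w [uin win ->]] /=; rewrite -mem_dyck_paths win uin.
  by case/mapP: uin => ? _ ->.
have uL : uniq L.
  apply: allpairs_uniq_dep => [|u _|[? ?] [? ?] _ _ /= [-> ->]] //.
    by rewrite map_inj_uniq ?permutations_uniq // => ? ? [].
  by rewrite filter_uniq // words_uniq.
have mL : {in L, forall p, mirror_path p \in L}.
  move=> p pL; have [v u0 uin] := memL _ pL.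
  have [vm _ [perm hd] _ _] := mirror_pathP v u0.
  apply/allpairsPdep; exists (mirror_path p).1, (mirror_path p).2.
  rewrite mem_dyck_paths vm; split=> //.
  (* The root label [a] is kept, so cancelling it leaves a rearrangement of [k]. *)
  case/mapP: uin perm hd => k' k'in ->.
  case: (mirror_path p).1 => [|a' u'] perm /= aE.
    by have := perm_size perm.
  rewrite aE perm_cons in perm *; rewrite map_f // mem_permutations.
  by rewrite mem_permutations in k'in; apply: perm_trans perm k'in.
have mK : {in L, forall p, mirror_path (mirror_path p) = p}.
  by move=> p /memL[v u0 _]; have [] := mirror_pathP v u0.
have CE : Ctilde a k = (\sum_(p <- L) ('X^(area p.1 p.2))%:P * 'X^(depth p.1 p.2))%R.
  by rewrite big_allpairs_dep.
(* Only the right-hand sum is reindexed; each of its terms then has area and depth exchanged, as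
   [swapXY] does on the left. *)
rewrite CE rmorph_sum -[in RHS](perm_big _ (mirror_path_perm uL mL mK)) big_map /=.
apply: eq_big_seq => p /memL[v u0 _]; have [_ _ _ -> ->] := mirror_pathP v u0.
by rewrite rmorphM /= swapXY_polyC map_polyXn rmorphXn /= swapXY_X -polyC_exp mulrC.
Qed.
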